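(* Let $W\ge 1$ be the number of ranks and $N\ge 1$ the number of dataset identities, and run one logical iteration of the protocol in join mode, with the padded distributed sampler (no dropping of the last views). Thus each rank emits all of its remaining (sampler-pending) and outstanding (worker-queue and collate-buffer) sampler views before advertising local finish, and every rank keeps participating in the shared communication protocol until all ranks have advertised local finish. Then, at the completion of the logical iteration: (1) the multiset of sampler views emitted by all ranks equals the whole sampler multiset $\biguplus_{r}\mathcal D_r$, which has cardinality $M=W\lceil N/W\rceil$; (2) its projection to dataset identities covers all $N$ identities; and (3) the per-iteration logical discard is $\eta_{\mathrm{logical}}=0$.
   Context: Sampler. Dataset identities are $\mathcal I=\{0,\dots,N-1\}$. A globally shuffled list of all $N$ identities is extended, by cyclically re-using identities of the list, to a list of $M=W\lceil N/W\rceil$ entries called sampler views (so a repeated identity gives distinct views); $P=M-N$ is the number of padding views. The list is stride-sharded over the ranks $r\in\{0,\dots,W-1\}$, so rank $r$ receives a family $\mathcal D_r$ of $q=\lceil N/W\rceil$ views; view positions are disjoint across ranks, and each view projects to its identity. State. At protocol round $k$, rank $r$ has state $(R_r,Q_r,B_r,E_r)$: $R_r$ = sampler-pending (remaining) views, not yet yielded; $Q_r$ = views in the worker queue; $B_r$ = views in the collate buffer, not yet emitted; $E_r$ = views already emitted to the trainer. Initially $R_r=\mathcal D_r$ and the other components are empty. The only state changes are: Fetch (move a subset of $R_r$ to $Q_r$), Drain (move $Q_r$ into $B_r$), Emit (move a group $g\subseteq B_r$ to $E_r$), and the no-op. The outstanding set of rank $r$ is $U_r=Q_r\uplus B_r$.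 Join mode. A rank advertises local finish only when $R_r=\emptyset$ and $U_r=\emptyset$ (drain before finish). In each round all ranks exchange their status by a collective all-gather, and the logical iteration is completed exactly when the shared status shows that all ranks have advertised local finish. Logical discard. $\eta_{\mathrm{logical}}:=\frac1N\sum_{r=0}^{W-1}|U_r|$, evaluated at the end of the logical iteration. *)

(* Defs.v *)
From mathcomp Require Export all_boot all_order all_algebra.
From mathcomp Require Export perm finmap multiset.
From Stdlib Require Export Relation_Operators.

Set Implicit Arguments.
Unset Strict Implicit.
Unset Printing Implicit Defensive.

Local Open Scope mset_scope.
Local Open Scope nat_scope.

(* The ceiling of N / W, for W > 0. *)
Definition shard_size (N W : nat) : nat := (N + W.-1) %/ W.

Definition num_views (N W : nat) : nat := W * shard_size N W.

(* A view is a position of the extended list, so that two occurrences of the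
   same identity are distinct views. *)
Notation view N W := 'I_(num_views N W).

(* The permutation s stands for the shuffled list s 0, ..., s (N - 1). Its first
   num_views N W - N entries, taken cyclically, are appended to it; the padding
   can be longer than N when N < W. *)
Definition sampler_list (N W : nat) (N_gt0 : 0 < N) (s : 'S_N) :
    (num_views N W).-tuple 'I_N :=
  [tuple s (Ordinal (ltn_pmod j N_gt0)) | j < num_views N W].

Definition identity (N W : nat) (N_gt0 : 0 < N) (s : 'S_N) (v : view N W) :
    'I_N :=
  tnth (sampler_list W N_gt0 s) v.

Definition shard (N W : nat) (r : 'I_W) : {mset view N W} :=
  seq_mset [seq v : view N W <- enum (view N W) | v %% W == r].

Definition sampler_multiset (N W : nat) : {mset view N W} :=
  \big[@msetD (view N W)/mset0]_(r < W) shard N r.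

Record rank_state (V : choiceType) := RankState {
  pending : {mset V};
  queue   : {mset V};
  buffer  : {mset V};
  emitted : {mset V}
}.

Definition outstanding (V : choiceType) (x : rank_state V) : {mset V} :=
  queue x `+` buffer x.

Inductive local_step (V : choiceType) : rank_state V -> rank_state V -> Prop :=
| Fetch (R Q B E g : {mset V}) of g `<=` R :
    local_step (RankState R Q B E) (RankState (R `\` g) (Q `+` g) B E)
| Drain (R Q B E : {mset V}) :
    local_step (RankState R Q B E) (RankState R mset0 (B `+` Q) E)
| Emit (R Q B E g : {mset V}) of g `<=` B :
    local_step (RankState R Q B E) (RankState R Q (B `\` g) (E `+` g))
| Noop (x : rank_state V) : local_step x x.

(* [state k r] is the state of rank r when the status exchange of round k takes
   place, [advertises k r] says that rank r advertises local finish in round k,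
   and [participates k r] that it takes part in the collective of round k. *)
Record run (W : nat) (V : choiceType) := Run {
  state        : nat -> 'I_W -> rank_state V;
  advertises   : nat -> 'I_W -> bool;
  participates : nat -> 'I_W -> bool
}.

Section Protocol.

Variables (W : nat) (V : choiceType).
Implicit Types (x : run W V) (k : nat) (r : 'I_W).

Definition has_advertised x k r : bool :=
  [exists j : 'I_k.+1, advertises x j r].

(* A collective returns only if every rank takes part in it. *)
Definition all_gather x k : option {ffun 'I_W -> bool} :=
  if [forall r, participates x k r] then Some [ffun r => has_advertised x k r]
  else None.

Definition all_finished x k : bool :=
  if all_gather x k is Some status then [forall r, status r] else false.

(* No round before k has completed the iteration, so round k takes place. The
   values of a run at later rounds carry no meaning. *)
Definition active x k : Prop := forall j, j < k -> ~~ all_finished x j.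

Definition completes_at x k : Prop := active x k /\ all_finished x k.

(* Between two status exchanges a rank performs any finite number of changes. *)
Definition is_execution (D : 'I_W -> {mset V}) x : Prop :=
  (forall r, state x 0 r = RankState (D r) mset0 mset0 mset0) /\
  (forall k r, active x k.+1 ->
     clos_refl_trans _ (@local_step V) (state x k r) (state x k.+1 r)).

Definition join_mode x : Prop :=
  (forall k r, active x k -> advertises x k r ->
     pending (state x k r) = mset0 /\ outstanding (state x k r) = mset0) /\
  (forall k r, active x k -> participates x k r).

Definition total_emitted x k : {mset V} :=
  \big[@msetD V/mset0]_(r < W) emitted (state x k r).

Definition logical_discard (N : nat) x k : rat :=
  (N%:R^-1 * \sum_(r < W) (size (outstanding (state x k r)))%:R)%R.

End Protocol.

(* Main.v *)
(* The views that a rank has not emitted yet, pending or outstanding, can only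
   decrease, and with the emitted ones they always add up to the shard. A rank
   has none left when it advertises local finish, hence none when the iteration
   completes, and by then it has emitted its whole shard. Each view lies in the
   shard of its residue modulo W and of no other, so the shards add up to the
   set of all views; as M is at least N, every identity occurs among the first
   N of them. *)
Require Import Defs.
From mathcomp Require Import zify.

Set Implicit Arguments.
Unset Strict Implicit.
Unset Printing Implicit Defensive.

Local Open Scope mset_scope.
Local Open Scope nat_scope.

Section RankDynamics.

Variable V : choiceType.
Implicit Types x y : rank_state V.

Definition unemitted x : {mset V} := pending x `+` outstanding x.

Lemma local_step_conserves x y : local_step x y ->
  unemitted y `+` emitted y = unemitted x `+` emitted x.
Proof.
(* Multiplicities are compared view by view; in Fetch and Emit, [g] lies inside its source, which
   makes the truncated subtraction exact. *)
case=> [R Q B E g /msubsetP le_g|R Q B E|R Q B E g /msubsetP le_g|//];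
  apply/msetP=> v; rewrite /unemitted /outstanding /= !(mset0E, msetE2);
  try have := le_g v; lia.
Qed.

(** Fetch and Drain only move views between the components summed in [unemitted], while Emit takes
    [g] out of it. *)
Lemma local_step_unemitted x y : local_step x y -> unemitted y `<=` unemitted x.
Proof.
case=> [R Q B E g /msubsetP le_g|R Q B E|R Q B E g /msubsetP le_g|z];
  apply/msubsetP=> v; rewrite /unemitted /outstanding /= ?(mset0E, msetE2) //;
  try have := le_g v; lia.
Qed.

Local Notation local_steps := (clos_refl_trans _ (@local_step V)).

Lemma local_steps_conserve x y : local_steps x y ->
  unemitted y `+` emitted y = unemitted x `+` emitted x.
Proof.
by elim=> {x y} [x y /local_step_conserves|//|x y z _ <- _ ->].
Qed.

Lemma local_steps_unemitted x y : local_steps x y -> unemitted y `<=` unemitted x.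
Proof.
elim=> {x y} [x y /local_step_unemitted //|x|x y z _ le_yx _ le_zy].
  exact: msubset_refl.
exact: msubset_trans le_zy le_yx.
Qed.

End RankDynamics.

Section Execution.

Variables (W : nat) (V : choiceType) (D : 'I_W -> {mset V}) (x : run W V).
Hypothesis exec : is_execution D x.

Lemma active_le j k : j <= k -> active x k -> active x j.
Proof. by move=> le_jk act i lt_ij; apply: act; apply: leq_trans le_jk. Qed.

Lemma steps_between j k r : j <= k -> active x k ->
  clos_refl_trans _ (@local_step V) (state x j r) (state x k r).
Proof.
elim: k => [|k IHk]; first by rewrite leqn0 => /eqP-> _; apply: rt_refl.
rewrite leq_eqVlt => /predU1P[-> _|]; first exact: rt_refl.
rewrite ltnS => le_jk act; apply: rt_trans (IHk le_jk _) _.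
  exact: active_le act.
exact: exec.2.
Qed.

Lemma active_conserves k r : active x k ->
  unemitted (state x k r) `+` emitted (state x k r) = D r.
Proof.
move=> act; rewrite (local_steps_conserve (steps_between r (leq0n k) act)).
by rewrite exec.1 /unemitted /outstanding /= !msetD0.
Qed.

Lemma completion_unemitted k r : join_mode x -> completes_at x k ->
  unemitted (state x k r) = mset0.
Proof.
move=> [drained _] [act]; rewrite /all_finished /all_gather.
(* Without full participation [all_gather] is [None] and nothing completes. Otherwise the shared
   status supplies a round [j <= k], possibly earlier than [k], in which [r] advertised;
   monotonicity carries emptiness from [j] to [k]. *)
case: ifP => // _ /forallP/(_ r); rewrite ffunE => /existsP[[j lt_jk] /= adv].
have le_jk : j <= k := lt_jk.
have act_j : active x j := active_le le_jk act.
have [pend0 out0] := drained j r act_j adv.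
apply/eqP; rewrite -msubset0.
have := local_steps_unemitted (steps_between r le_jk act).
by rewrite {2}/unemitted pend0 out0 msetD0.
Qed.

Lemma completion_outstanding k r : join_mode x -> completes_at x k ->
  outstanding (state x k r) = mset0.
Proof.
move=> join compl; apply/eqP; rewrite -msubset0.
rewrite -(completion_unemitted r join compl).
by apply/msubsetP=> v; rewrite [leqRHS]msetE2 leq_addl.
Qed.

Lemma completion_emitted k r : join_mode x -> completes_at x k ->
  emitted (state x k r) = D r.
Proof.
move=> join compl; rewrite -(@active_conserves k) ?completion_unemitted //.
  by rewrite mset0D.
exact: compl.1.
Qed.

End Execution.

Section Sampler.

Variables W N : nat.
Hypothesis W_gt0 : 0 < W.

(** Dividing [N + W.-1] by [W] leaves a remainder of at most [W.-1], so the multiple of [W] that is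
    split off is at least [N]. *)
Lemma leq_num_views : N <= num_views N W.
Proof.
have := divn_eq (N + W.-1) W; have := ltn_pmod (N + W.-1) W_gt0.
rewrite /num_views /shard_size; lia.
Qed.

Lemma shardE (r : 'I_W) (v : view N W) : shard N r v = (v %% W == r).
Proof.
rewrite /shard mset_seqE count_uniq_mem; last exact: filter_uniq (enum_uniq _).
by rewrite mem_filter mem_enum andbT.
Qed.

Lemma sampler_multisetE : sampler_multiset N W = seq_mset (enum (view N W)).
Proof.
apply/msetP=> v; rewrite /sampler_multiset.
(* Evaluation at [v] is additive, so the multiplicity of [v] becomes a sum over ranks, to which only
   the rank [v %% W] contributes. *)
rewrite (big_morph (fun A : {mset _} => A v) (id1 := 0) (op1 := addn));
  [|by move=> A B; rewrite msetE2|exact: mset0E].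
rewrite mset_seqE (count_uniq_mem _ (enum_uniq _)) mem_enum.
rewrite (bigD1 (Ordinal (ltn_pmod v W_gt0))) //= shardE eqxx big1 // => r.
by rewrite shardE eq_sym -val_eqE /= => /negbTE->.
Qed.

Lemma mem_sampler_multiset v : v \in sampler_multiset N W.
Proof. by rewrite sampler_multisetE (perm_mem (perm_eq_seq_mset _)) mem_enum. Qed.

Lemma size_sampler_multiset : size (sampler_multiset N W) = num_views N W.
Proof.
by rewrite sampler_multisetE (perm_size (perm_eq_seq_mset _)) size_enum_ord.
Qed.

Lemma identity_surj (N_gt0 : 0 < N) (s : 'S_N) (i : 'I_N) :
  exists v : view N W, identity N_gt0 s v = i.
Proof.
(* The witness is the place of [i] in the shuffled list; it lies below [N], so the cyclic index does
   not wrap around. *)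
exists (widen_ord leq_num_views (s^-1%g i)); rewrite /identity tnth_mktuple.
rewrite -[RHS](permKV s); congr (s _); apply: val_inj.
by rewrite /= modn_small.
Qed.

End Sampler.

Theorem theorem1 (W N : nat) (W_gt0 : 0 < W) (N_gt0 : 0 < N) (s : 'S_N)
    (x : run W (view N W)) (K : nat) :
  is_execution (@shard N W) x ->
  join_mode x ->
  completes_at x K ->
  [/\ total_emitted x K = sampler_multiset N W
      /\ size (sampler_multiset N W) = num_views N W,
      [set identity N_gt0 s v | v in total_emitted x K] = [set: 'I_N]
    & logical_discard N x K = 0%R].
Proof.
move=> exec join compl.
have emitted_all : total_emitted x K = sampler_multiset N W.
  by apply: eq_bigr => r _; exact: (completion_emitted exec r join compl).
split; first by split=> //; exact: size_sampler_multiset.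
  apply/setP=> i; rewrite inE emitted_all; apply/imsetP.
  have [v <-] := identity_surj W_gt0 N_gt0 s i.
  by exists v => //; exact: mem_sampler_multiset.
rewrite /logical_discard big1 ?GRing.mulr0 // => r _.
by rewrite (completion_outstanding exec r join compl) enum_mset0.
Qed.
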